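(* Let $\alpha > 1$ be a constant integer. There is a polynomial-time $O\!\left(n^{1-\frac{1}{\alpha}}(\log n)^{\frac{1}{\alpha}}\right)$-approximation algorithm for the 1-DR-$\alpha$ problem, where $n$ is the number of vertices of the input graph.
   Context: For a graph $G=(V,E)$ and $S\subseteq V$, $G[S]$ is the subgraph induced by $S$. For vertices $u,v$, $m_G(u,v)$ is the number of internal vertices on a shortest $u$–$v$ path in $G$ (so $m_G(u,v)=0$ if $u,v$ are adjacent, and $m_G(u,v)=1$ if they are non-adjacent but have a common neighbor); it is $\infty$ if no path exists. For $D\subseteq V$, $m^D_G(u,v)=m_{G[D\cup\{u,v\}]}(u,v)$. Two vertices $u,v$ form a target couple $[u,v]$ if $m_G(u,v)=1$. A set $D$ covers a target couple $[u,v]$ if $m^D_G(u,v)\le\alpha$. A set $D$ is a dominating set if every vertex of $V\setminus D$ is adjacent to a vertex of $D$. The 1-DR-$\alpha$ problem ($\alpha$ a positive integer): given a connected graph $G$, find a minimum-cardinality dominating set $D$ of $G$ that covers every target couple of $G$. An $r$-approximation algorithm outputs a feasible solution of size at most $r$ times the optimum. *)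

(* Defs.v *)
From HB Require Import structures.
From mathcomp Require Import all_boot all_order all_algebra.
From mathcomp Require Import all_classical all_reals all_analysis.

Set Implicit Arguments.
Unset Strict Implicit.
Unset Printing Implicit Defensive.

Import Order.TTheory GRing.Theory Num.Theory.
Import numFieldNormedType.Exports.

Local Open Scope nat_scope.

(** * Graphs: the edge relation of a graph with vertex set V is e : rel V *)

Section Graphs.

Variable V : finType.
Implicit Types (e : rel V) (u v : V) (S D : {set V}) (p : seq V).

Definition simple_graph e : Prop := symmetric e /\ irreflexive e.

Definition connected_graph e : Prop :=
  0 < #|V| /\ forall u v, connect e u v.

(* G[S].  Vertices outside S stay in the type V, but are isolated, so they lie
   on no path joining two vertices of S. *)
Definition induced e S : rel V :=
  [rel x y | [&& x \in S, y \in S & e x y]].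

(* u :: p is the vertex sequence of a u-v path; its length is size p, and it
   has (size p).-1 internal vertices. *)
Definition is_path e u v p : bool :=
  [&& path e u p, uniq (u :: p) & last u p == v].

(* Length of a shortest u-v path; the value is #|V| when there is no path, as
   every path has at most #|V| vertices, hence length < #|V|. *)
Definition path_dist e u v : nat :=
  find (fun k => [exists p : k.-tuple V, is_path e u v p]) (iota 0 #|V|).

(* m_G(u,v), with None for infinity. *)
Definition mG e u v : option nat :=
  if path_dist e u v < #|V| then Some (path_dist e u v).-1 else None.

Definition le_opt (x : option nat) (a : nat) : bool :=
  if x is Some k then k <= a else false.

Definition mGD e D u v : option nat := mG (induced e (D :|: [set u; v])) u v.

Definition target_couple e u v : Prop := mG e u v = Some 1.

Definition covers (alpha : nat) e D u v : Prop := le_opt (mGD e D u v) alpha.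

Definition dominating e D : Prop :=
  forall x, x \notin D -> exists2 y, y \in D & e x y.

Definition feasible (alpha : nat) e D : Prop :=
  dominating e D /\ forall u v, target_couple e u v -> covers alpha e D u v.

Definition optimal (alpha : nat) e D : Prop :=
  feasible alpha e D /\ forall D', feasible alpha e D' -> #|D| <= #|D'|.

Lemma path_distP e u v k :
  path_dist e u v = k -> k < #|V| ->
  (exists2 p, is_path e u v p & size p = k) /\
  (forall p, is_path e u v p -> k <= size p).
Proof.
rewrite /path_dist => Hk ltkV.
have hs : has (fun k => [exists p : k.-tuple V, is_path e u v p]) (iota 0 #|V|).
  by rewrite has_find size_iota Hk.
split.
  have := nth_find 0 hs; rewrite Hk nth_iota // add0n.
  by case/existsP => p Hp; exists p => //; rewrite size_tuple.
move=> p Hp; case: leqP => // ltpk.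
have := @before_find _ 0 (fun k => [exists p : k.-tuple V, is_path e u v p])
  (iota 0 #|V|) (size p).
rewrite Hk => /(_ ltpk); rewrite nth_iota ?add0n; last exact: ltn_trans ltkV.
by move/existsP; case; exists (in_tuple p).
Qed.

Lemma mG_NoneP e u v : mG e u v = None <-> (forall p, ~~ is_path e u v p).
Proof.
rewrite /mG; set d := path_dist e u v; split.
  case: ifP => // /negbT; rewrite -leqNgt => Vd _ p; apply/negP => Hp.
  have szp : size p < #|V|.
    case/and3P: (Hp) => _ Up _.
    by have := card_uniqP Up => /= <-; rewrite max_card.
  have := @before_find _ 0 (fun k => [exists p : k.-tuple V, is_path e u v p])
    (iota 0 #|V|) (size p) (leq_trans szp Vd).
  rewrite nth_iota ?add0n // => /existsP; case.
  by exists (in_tuple p).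
move=> noP; case: ifP => // ltd.
by have [[p Hp _] _] := path_distP (erefl d) ltd; rewrite (negbTE (noP p)) in Hp.
Qed.

End Graphs.

(** * Computation model: unit-cost random-access machine *)

(* Registers and memory cells hold natural numbers.  The only arithmetic is
   addition and (truncated) subtraction, so that a run of t unit-cost steps only
   produces numbers of bit length O(t + input size): polynomial time here
   agrees with polynomial time on Turing machines (multiplication at unit cost
   would break this). *)
Inductive prog : Type :=
| Skip
| Const of nat & nat              (* x := k *)
| Add of nat & nat & nat          (* x := y + z *)
| Sub of nat & nat & nat          (* x := y - z *)
| Read of nat & nat               (* x := M[y] *)
| Write of nat & nat              (* M[x] := y *)
| Seq of prog & prog
| If of nat & prog & prog         (* if x != 0 then .. else .. *)
| While of nat & prog.            (* while x != 0 do .. *)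

Record state : Type := State { reg : nat -> nat; mem : nat -> nat }.

Definition upd (f : nat -> nat) (a k : nat) : nat -> nat :=
  fun b => if b == a then k else f b.

Definition set_reg (s : state) (x k : nat) : state :=
  State (upd (reg s) x k) (mem s).

Definition set_mem (s : state) (a k : nat) : state :=
  State (reg s) (upd (mem s) a k).

(* exec c s t s': started in state s, program c halts in state s' after t steps
   (basic instructions and tests cost one step each). *)
Inductive exec : prog -> state -> nat -> state -> Prop :=
| ExecSkip s : exec Skip s 1 s
| ExecConst s x k : exec (Const x k) s 1 (set_reg s x k)
| ExecAdd s x y z : exec (Add x y z) s 1 (set_reg s x (reg s y + reg s z))
| ExecSub s x y z : exec (Sub x y z) s 1 (set_reg s x (reg s y - reg s z))
| ExecRead s x y : exec (Read x y) s 1 (set_reg s x (mem s (reg s y)))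
| ExecWrite s x y : exec (Write x y) s 1 (set_mem s (reg s x) (reg s y))
| ExecSeq c1 c2 s t1 s1 t2 s2 :
    exec c1 s t1 s1 -> exec c2 s1 t2 s2 -> exec (Seq c1 c2) s (t1 + t2) s2
| ExecIfT x c1 c2 s t s' :
    reg s x != 0 -> exec c1 s t s' -> exec (If x c1 c2) s t.+1 s'
| ExecIfF x c1 c2 s t s' :
    reg s x = 0 -> exec c2 s t s' -> exec (If x c1 c2) s t.+1 s'
| ExecWhileF x c s : reg s x = 0 -> exec (While x c) s 1 s
| ExecWhileT x c s t1 s1 t2 s2 :
    reg s x != 0 -> exec c s t1 s1 -> exec (While x c) s1 t2 s2 ->
    exec (While x c) s (t1 + t2).+1 s2.

Lemma exec_det c s t1 s1 t2 s2 :
  exec c s t1 s1 -> exec c s t2 s2 -> t1 = t2 /\ s1 = s2.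
Proof.
move=> Hrun; move: t2 s2; induction Hrun => tf sf Hf; inversion Hf; subst => //;
  repeat match goal with
  | IH : forall t s, exec ?c ?a t s -> _, E : exec ?c ?a _ _ |- _ =>
      case: (IH _ _ E) => ? ?; subst; clear IH
  | nz : is_true (reg ?s ?x != 0), z : reg ?s ?x = 0 |- _ =>
      by rewrite z in nz
  end; by [].
Qed.

(** * Approximation algorithms *)

(* A graph on 'I_n is given as n in register 0 and its adjacency matrix, stored
   row by row in the cells 0, ..., n^2 - 1; everything else is 0. *)
Definition input_state n (e : rel 'I_n) : state :=
  State (fun x => if x == 0 then n else 0)
        (fun a => nat_of_bool
           [exists i : 'I_n, exists j : 'I_n, (a == i * n + j) && e i j]).

(* The output set is read off the cells n^2, ..., n^2 + n - 1 as an indicator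
   vector. *)
Definition output_set n (s : state) : {set 'I_n} :=
  [set i : 'I_n | mem s (n * n + i) != 0].

(* c is a polynomial-time r(n)-approximation algorithm for 1-DR-alpha.  The
   input has size Theta(n^2), so polynomial in n is polynomial in the input
   size.  The run is unique by exec_det. *)
Definition polytime_approx (R : realType) (alpha : nat) (r : nat -> R)
    (c : prog) : Prop :=
  exists P : {poly nat}, forall (n : nat) (e : rel 'I_n),
    simple_graph e -> connected_graph e ->
    exists t s,
      [/\ exec c (input_state e) t s,
          t <= P.[n]%R,
          feasible alpha e (output_set n s) &
          forall Dopt : {set 'I_n}, optimal alpha e Dopt ->
            (#|output_set n s|%:R <= r n * #|Dopt|%:R :> R)%R].

(* Main.v *)
Require Import Defs.
From HB Require Import structures.
From mathcomp Require Import all_boot all_order all_algebra.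
From mathcomp Require Import all_classical all_reals all_analysis.
From mathcomp Require Import zify ring lra.
Set Implicit Arguments.
Unset Strict Implicit.
Unset Printing Implicit Defensive.
Import Order.TTheory GRing.Theory Num.Theory.
Import numFieldNormedType.Exports.

(** Set cover over walks.  The elements to cover are the target couples and the
    diagonal pairs (u,u), which encode domination; the sets are the sequences
    of alpha vertices in which consecutive vertices are equal or adjacent, and
    such a walk covers (u,v) when its first vertex is u or a neighbour of u and
    its last vertex is v or a neighbour of v.  A set is feasible as soon as the
    walks inside it cover everything, and conversely the #|D|^alpha sequences
    over a feasible D contain a cover.  Greedy set cover therefore selects at
    most OPT^alpha * H(n^2) walks, so it outputs at most
    min(n, O(OPT^alpha log n)) vertices, and the weighted geometric mean of the
    two bounds is O(n^(1-1/alpha) (log n)^(1/alpha)) * OPT.  Greedy is run with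
    a threshold K going down from n^2 to 1: one pass over all walks selects
    those that cover at least K uncovered pairs, and since the previous pass
    left no walk covering more than K, every selection is a greedy one. *)

Local Open Scope nat_scope.

(** * Total correctness with time bounds *)

(** Runs are unique by [exec_det], so the existence of one run ending in [Q] within [T] steps
    amounts to total correctness. *)
Definition ens (c : prog) (s : state) (T : nat) (Q : state -> Prop) : Prop :=
  exists t s', [/\ exec c s t s', t <= T & Q s'].

Fixpoint mods (c : prog) : seq nat :=
  match c with
  | Skip | Write _ _ => [::]
  | Const x _ | Add x _ _ | Defs.Sub x _ _ | Read x _ => [:: x]
  | Seq c1 c2 | If _ c1 c2 => mods c1 ++ mods c2
  | While _ c => mods c
  end.

Lemma exec_frame c s t s' :
  exec c s t s' -> forall r, r \notin mods c -> reg s' r = reg s r.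
Proof.
have upd_ne f a k r : r \notin [:: a] -> upd f a k r = f r.
  by rewrite inE /upd => /negbTE->.
elim=> {c s t s'} //=; try by move=> *; rewrite upd_ne.
- move=> c1 c2 s t1 s1 t2 s2 _ IH1 _ IH2 r; rewrite mem_cat negb_or.
  by case/andP=> r1 r2; rewrite IH2 // IH1.
- by move=> x c1 c2 s t s' _ _ IH r; rewrite mem_cat negb_or => /andP[r1 _]; rewrite IH.
- by move=> x c1 c2 s t s' _ _ IH r; rewrite mem_cat negb_or => /andP[_ r1]; rewrite IH.
- by move=> x c s t1 s1 t2 s2 _ _ IH1 _ IH2 r rc; rewrite IH2 // IH1.
Qed.

Lemma ens_frame c s T (Q : state -> Prop) :
  ens c s T Q ->
  ens c s T (fun s' => (forall r, r \notin mods c -> reg s' r = reg s r) /\ Q s').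
Proof. by case=> t [s' [H ? ?]]; exists t, s'; split=> //; split=> //;
  exact: exec_frame H. Qed.

Lemma ens_weaken c s T T' (Q Q' : state -> Prop) :
  T <= T' -> (forall s', Q s' -> Q' s') -> ens c s T Q -> ens c s T' Q'.
Proof. by move=> le_T QQ' [t [s' [H le_t Qs]]]; exists t, s'; split;
  [|exact: leq_trans le_T|exact: QQ']. Qed.

Lemma ens_skip s T (Q : state -> Prop) : 0 < T -> Q s -> ens Skip s T Q.
Proof. by move=> T0 Qs; exists 1, s; split=> //; constructor. Qed.

Lemma ens_const x k s T (Q : state -> Prop) :
  Q (set_reg s x k) -> ens (Const x k) s T.+1 Q.
Proof. by move=> Qs; exists 1; eexists; split; [constructor|done|]. Qed.

Lemma ens_add x y z s T (Q : state -> Prop) :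
  Q (set_reg s x (reg s y + reg s z)) -> ens (Add x y z) s T.+1 Q.
Proof. by move=> Qs; exists 1; eexists; split; [constructor|done|]. Qed.

Lemma ens_sub x y z s T (Q : state -> Prop) :
  Q (set_reg s x (reg s y - reg s z)) -> ens (Defs.Sub x y z) s T.+1 Q.
Proof. by move=> Qs; exists 1; eexists; split; [constructor|done|]. Qed.

Lemma ens_read x y s T (Q : state -> Prop) :
  Q (set_reg s x (Defs.mem s (reg s y))) -> ens (Read x y) s T.+1 Q.
Proof. by move=> Qs; exists 1; eexists; split; [constructor|done|]. Qed.

Lemma ens_write x y s T (Q : state -> Prop) :
  Q (Defs.set_mem s (reg s x) (reg s y)) -> ens (Write x y) s T.+1 Q.
Proof. by move=> Qs; exists 1; eexists; split; [constructor|done|]. Qed.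

Lemma ens_seq c1 c2 s T1 T2 (Q : state -> Prop) :
  ens c1 s T1 (fun s1 => ens c2 s1 T2 Q) -> ens (Seq c1 c2) s (T1 + T2) Q.
Proof.
move=> [t1 [s1 [H1 le1 [t2 [s2 [H2 le2 Qs]]]]]].
by exists (t1 + t2), s2; split=> //; [exact: ExecSeq H2|exact: leq_add].
Qed.

Lemma ens_seq1 c1 c2 s T (Q : state -> Prop) :
  ens c1 s 1 (fun s1 => ens c2 s1 T Q) -> ens (Seq c1 c2) s T.+1 Q.
Proof. exact: ens_seq. Qed.

Lemma ens_if x c1 c2 s T (Q : state -> Prop) :
  (reg s x != 0 -> ens c1 s T Q) -> (reg s x = 0 -> ens c2 s T Q) ->
  ens (If x c1 c2) s T.+1 Q.
Proof.
move=> H1 H2; have [x0|x0] := eqVneq (reg s x) 0.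
  by have [t [s' [H le_t Qs]]] := H2 x0; exists t.+1, s'; split=> //; exact: ExecIfF.
by have [t [s' [H le_t Qs]]] := H1 x0; exists t.+1, s'; split=> //; exact: ExecIfT.
Qed.

(** The invariant is indexed by the value of the test register, which is also the number of
    iterations left. Each iteration pays one step for its test, and the final failing test one
    more. *)
Lemma ens_while x c N T (I : nat -> state -> Prop) s :
  (forall k s1, I k s1 -> reg s1 x = k) ->
  (forall k s1, k < N -> I k.+1 s1 -> ens c s1 T (I k)) ->
  I N s -> ens (While x c) s (N * T.+1).+1 (I 0).
Proof.
move=> Ix; elim: N s => [|N IH] s step IN.
  by exists 1, s; split=> //; constructor; exact: Ix.
have [t1 [s1 [H1 le1 I1]]] := step N s (leqnn _) IN.
have [|t2 [s2 [H2 le2 I2]]] := IH s1 _ I1; first by move=> k s' kN; apply: step;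
  exact: ltnW.
exists (t1 + t2).+1, s2; split=> //; last lia.
by apply: ExecWhileT H1 H2; rewrite (Ix _ _ IN).
Qed.

(** * Counting loops *)

(* Register conventions: 0 holds n, 1 holds the constant 1, 2 is the loop test,
   3 is scratch, 7 is an accumulator; further on, 4 and 5 hold the addresses
   n * n and n * n + n of the output and of the table of uncovered pairs, 6 the
   greedy threshold, and 14 the constant 0.  A loop variable x has its multiple
   x * n in register x.+1, as the machine has no multiplication. *)
Definition For (x : nat) (c : prog) : prog :=
  Seq (Const x 0) (Seq (Const x.+1 0) (Seq (Defs.Sub 2 0 x)
    (While 2 (Seq c (Seq (Add x x 1) (Seq (Add x.+1 x.+1 0) (Defs.Sub 2 0 x))))))).

Lemma mods_For x c r :
  (r \in mods (For x c)) = [|| r == x, r == x.+1, r == 2 | r \in mods c].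
Proof.
rewrite /= !(mem_cat, inE); case: (r \in mods c); rewrite ?orbT //.
by case: (r == x); case: (r == x.+1); case: (r == 2).
Qed.

(** Per iteration: the test and the three updates after the body. Outside: three initialisations and
    the failing test. *)
Definition forT (n T : nat) : nat := n * T.+4 + 4.

(** Register 2 is absent from the list, so bodies may contain loops: the test value is recomputed
    from [x] after each run of the body. *)
Definition loop_ok (x : nat) (c : prog) : bool :=
  (7 < x) && all (fun r => r \notin mods c) [:: 0; 1; x; x.+1].

(** [J] sees only the accumulator and the memory; what a body needs to know about other registers
    comes from the frame condition. *)
Lemma ens_for n x c T (J : nat -> nat -> (nat -> nat) -> Prop) s :
  reg s 0 = n -> reg s 1 = 1 -> loop_ok x c ->
  (forall (k : 'I_n) s1, (forall r, r \notin mods (For x c) -> reg s1 r = reg s r) ->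
     reg s1 x = k -> reg s1 x.+1 = k * n -> J k (reg s1 7) (Defs.mem s1) ->
     ens c s1 T (fun s2 => J k.+1 (reg s2 7) (Defs.mem s2))) ->
  J 0 (reg s 7) (Defs.mem s) ->
  ens (For x c) s (forT n T)
    (fun s' => (forall r, r \notin mods (For x c) -> reg s' r = reg s r) /\
               J n (reg s' 7) (Defs.mem s')).
Proof.
move=> s0 s1 /andP[gtx /and5P[c0 c1 cx cx1 _]] step J0; apply: ens_frame.
have neqs : [/\ (0 == x) = false, (1 == x) = false, (2 == x) = false, (7 == x) = false &
  (2 == x.+1) = false].
  by split; apply/eqP; lia.
have [n0 n1 n2 n7 n2'] := neqs.
have [m0 m1 m7] : [/\ (0 == x.+1) = false, (1 == x.+1) = false & (7 == x.+1) = false].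
  by split; apply/eqP; lia.
have [p0 p1] : (x == x.+1) = false /\ (x.+1 == x) = false by split; apply/eqP; lia.
have [q0 q1] : (x == 2) = false /\ (x.+1 == 2) = false by split; apply/eqP; lia.
have mE r : r \notin mods (For x c) -> [/\ r != x, r != x.+1, r != 2 & r \notin mods c].
  by rewrite /= !inE !mem_cat !inE !negb_or => /and5P[-> -> -> -> _].
rewrite /forT [_ + 4]addnC; apply/ens_seq1/ens_const/ens_seq1/ens_const/ens_seq1/ens_sub.
(* [d] counts the iterations left, so the loop variable is [n - d]; counting up becomes the
   countdown expected by [ens_while]. *)
pose I d s' := [/\ d <= n, reg s' 2 = d, (forall r, r \notin mods (For x c) ->
  reg s' r = reg s r),
  reg s' x = n - d /\ reg s' x.+1 = (n - d) * n & J (n - d) (reg s' 7) (Defs.mem s')].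
have I0 : I n (set_reg (set_reg (set_reg s x 0) x.+1 0) 2
    (reg (set_reg (set_reg s x 0) x.+1 0) 0 - reg (set_reg (set_reg s x 0) x.+1 0) x)).
  split=> //=; rewrite /upd ?eqxx ?p0 ?p1 ?q0 ?q1 ?n0 ?n7 ?m0 ?m7 /= ?s0 ?subnn ?subn0 //.
  by move=> r /mE[/negbTE-> /negbTE-> /negbTE-> _].
apply: ens_weaken (ens_while (N := n) (T := T.+3) (I := I) _ _ I0); first by lia.
- by move=> s' [_ _ _ _]; rewrite subn0.
- by move=> k s' [].
move=> k s' kn [_ s'2 s'fr [s'x s'x1] Js'].
have kn' : n - k.+1 < n by lia.
have s'0 : reg s' 0 = n by rewrite s'fr //= !inE !mem_cat !inE n0 m0 (negbTE c0).
have s'1 : reg s' 1 = 1 by rewrite s'fr //= !inE !mem_cat !inE n1 m1 (negbTE c1).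
have E : T.+3 = T + 3 by lia.
rewrite {}E; apply: ens_seq.
apply: ens_weaken (ens_frame (step (Ordinal kn') s' s'fr s'x s'x1 Js')) => // s2 [fr2 J2].
apply/ens_seq1/ens_add/ens_seq1/ens_add/ens_sub.
have e0 : reg s2 0 = n by rewrite fr2.
have e1 : reg s2 1 = 1 by rewrite fr2.
have ex : reg s2 x = n - k.+1 by rewrite fr2.
have ex1 : reg s2 x.+1 = (n - k.+1) * n by rewrite fr2.
have En : (n - k.+1).+1 = n - k by lia.
split=> //=; rewrite /upd ?eqxx ?p0 ?p1 ?q0 ?q1 ?n0 ?n1 ?n7 ?m0 ?m7 /= ?e0 ?e1 ?ex ?ex1 //.
- lia.
- by lia.
- move=> r r_c; case: (mE _ r_c) => [/negbTE-> /negbTE-> /negbTE-> rc].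
  by rewrite fr2 // s'fr.
- split; nia.
- by move: J2 => /=; rewrite En.
Qed.

(** * Loops that accumulate in a commutative monoid *)

Section BigLoops.

Variables (X : Type) (idx : X) (op : Monoid.com_law idx).

Lemma big_ord_ltS n (F : 'I_n -> X) (k : 'I_n) :
  \big[op/idx]_(i < n | i < k.+1) F i = op (\big[op/idx]_(i < n | i < k) F i) (F k).
Proof.
rewrite (bigD1 k) //= Monoid.mulmC; congr (op _ _); apply: eq_bigl => i.
by rewrite ltnS [in RHS]ltn_neqAle andbC.
Qed.

(** [J] carries the monoid value gathered so far. Addition serves to count pairs, union to record
    marked or deleted pairs. *)
Lemma ens_for_big n x c T (J : X -> nat -> (nat -> nat) -> Prop) (F : 'I_n -> X) y s :
  reg s 0 = n -> reg s 1 = 1 -> loop_ok x c ->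
  (forall (k : 'I_n) s1 y', (forall r, r \notin mods (For x c) -> reg s1 r = reg s r) ->
     reg s1 x = k -> reg s1 x.+1 = k * n -> J y' (reg s1 7) (Defs.mem s1) ->
     ens c s1 T (fun s2 => J (op y' (F k)) (reg s2 7) (Defs.mem s2))) ->
  J y (reg s 7) (Defs.mem s) ->
  ens (For x c) s (forT n T)
    (fun s' => (forall r, r \notin mods (For x c) -> reg s' r = reg s r) /\
               J (op y (\big[op/idx]_(k < n) F k)) (reg s' 7) (Defs.mem s')).
Proof.
move=> s0 s1 ok step Js.
have := ens_for (J := fun k => J (op y (\big[op/idx]_(i < n | i < k) F i))) s0 s1 ok.
move=> /(_ T) H; apply: ens_weaken (H _ _) => //.
- by move=> s' [fr]; rewrite (eq_bigl xpredT) // => i; rewrite ltn_ord.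
- move=> k s2 fr kx kx1 Jk; rewrite big_ord_ltS Monoid.mulmA; exact: step.
- by rewrite big_pred0 ?Monoid.mulm1.
Qed.

End BigLoops.

(** * Walks and feasible sets *)

Section Requirements.

Variables (V : finType) (e : rel V).
Hypothesis e_simple : simple_graph e.
Implicit Types (D : {set V}) (U : {set V * V}) (x : V) (q : seq V).

(** Equality is allowed so that short walks can be padded to a fixed length. *)
Definition reflcl : rel V := [rel x y | (x == y) || e x y].

Definition required : {set V * V} :=
  [set p | (p.1 == p.2) || [exists y, [&& e p.1 y, e y p.2 & ~~ e p.1 p.2]]].

Definition reach x q : {set V * V} :=
  [set p | reflcl p.1 x && reflcl (last x q) p.2].

(** [k] counts steps: the walk [x :: q] has [k.+1] vertices, and [k.+1] plays the role of alpha. *)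
Definition walk_covered (k : nat) D (p : V * V) : Prop :=
  exists x q, [/\ size q = k, path reflcl x q, all (mem D) (x :: q) & p \in reach x q].

Lemma reflcl_sym : symmetric reflcl.
Proof. by move=> x y; rewrite /reflcl /= eq_sym e_simple.1. Qed.

Lemma simple_irr x : e x x = false.
Proof. exact: e_simple.2. Qed.

Lemma reflcl_path_nseq x k : path reflcl x (nseq k x).
Proof. by elim: k => //= k ->; rewrite /reflcl /= eqxx. Qed.

Lemma last_nseq x k : last x (nseq k x) = x.
Proof. by elim: k. Qed.

Lemma sub_reflcl : subrel e reflcl.
Proof. by move=> x y; rewrite /reflcl /= => ->; rewrite orbT. Qed.

Lemma mG_le (e' : rel V) u v p : is_path e' u v p -> le_opt (mG e' u v) (size p).-1.
Proof.
move=> pp; case E: (mG e' u v) => [k|]; last by have /mG_NoneP/(_ p) := E; rewrite pp.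
move: E; rewrite /mG; case: ifP => // lt [<-] /=.
by have [_ /(_ _ pp)] := path_distP erefl lt; move=> h; rewrite -!subn1 leq_sub2r.
Qed.

Lemma mG_le_path (e' : rel V) u v k :
  le_opt (mG e' u v) k -> exists2 p, is_path e' u v p & size p <= k.+1.
Proof.
rewrite /mG; case: ifP => //= lt le_k.
by have [[p pp sp] _] := path_distP erefl lt; exists p => //; rewrite sp;
  case: path_dist le_k.
Qed.

(** The value 1 of [mG] means a shortest path of two edges, whose middle vertex is the common
    neighbour. *)
Lemma target_coupleP u v :
  target_couple e u v <-> u != v /\ (u, v) \in required.
Proof.
split.
  rewrite /target_couple /mG; case: ifP => // lt [d1].
  have [[p /and3P[pp up /eqP lp] sp] short] := path_distP erefl lt.
  have d2 : path_dist e u v = 2 by case: path_dist d1 => // -[|[|]].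
  case: p sp pp up lp => [|y [|z [|]]] /=; rewrite d2 // => _ /and3P[uy yz _] /andP[].
  rewrite !inE negb_or => /andP[_ uz] _ zv; subst z; split=> //=.
  apply/orP; right; apply/existsP; exists y; rewrite uy yz /=; apply/negP => uv.
  have := short [:: v]; rewrite d2 /is_path /= uv inE uz eqxx; move/(_ isT); lia.
rewrite inE /= => -[uv]; rewrite (negbTE uv) => /existsP[y /and3P[uy yv nuv]].
have pp : is_path e u v [:: y; v].
  rewrite /is_path /= uy yv !inE eqxx negb_or uv !andbT /=.
  by apply/andP; split; apply/eqP => E; subst y; rewrite simple_irr in uy yv.
(* The two-edge path bounds the value by 1; the value 0 would force [u] and [v] to be equal or
   adjacent. *)
have := mG_le pp; rewrite /target_couple; case E: (mG e u v) => [[|[|]]|] //= _.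
exfalso; have [|p /and3P[pe ue /eqP lp] sp] := @mG_le_path e u v 0; first by rewrite E.
case: p sp pe ue lp => [|z [|]] //= _; first by move=> _ _ E'; rewrite E' eqxx in uv.
by rewrite andbT => uz _ zv; subst z; rewrite uz in nuv.
Qed.

Lemma induced_path D x p : path (Defs.induced e D) x p -> all (mem D) p.
Proof. by elim: p x => //= y p IH x /andP[/and3P[_ -> _] /IH]. Qed.

(** Diagonal pairs yield dominating vertices. For a target couple, enclosing the walk between [u]
    and [v] gives [k.+3] vertices; removing repetitions leaves a path with at most [k.+1] internal
    vertices. *)
Lemma covered_feasible k D :
  (forall p, p \in required -> walk_covered k D p) -> feasible k.+1 e D.
Proof.
move=> cov; split.
  move=> x xD; have [|y [q [_ _ /= /andP[yD _]]]] := cov (x, x); first by rewrite inE eqxx.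
  rewrite inE /reflcl /= => /andP[/orP[/eqP xy|xy] _]; last by exists y.
  by rewrite -xy (negbTE xD) in yD.
move=> u v /target_coupleP[uv /cov[x [q [sq pq Dq]]]]; rewrite inE /= => /andP[ux qv].
rewrite /covers /mGD; set S := D :|: [set u; v].
(* Stationary steps are still allowed here; they disappear once the walk is shortened to one without
   repeated vertices. *)
pose e'' : rel V := [rel a b | [&& a \in S, b \in S & reflcl a b]].
have inS y : y \in D -> y \in S by rewrite inE => ->.
have uS : u \in S by rewrite !inE eqxx orbT.
have vS : v \in S by rewrite !inE eqxx !orbT.
have pS y r : all (mem S) (y :: r) -> path reflcl y r -> path e'' y r.
  elim: r y => //= z r IH y /and3P[yS zS rS] /andP[yz zr].
  by apply/andP; split; [rewrite /e'' /= yS zS|apply: IH => //=; rewrite zS].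
have pw : path e'' u (x :: rcons q v).
  apply: pS; last by rewrite /= rcons_path ux pq qv.
  apply/allP => y; rewrite inE -rcons_cons mem_rcons inE.
  by case/or3P=> [/eqP->|/eqP->|/(allP Dq)/inS].
have wv : last u (x :: rcons q v) = v by rewrite /= last_rcons.
move: (wv); have [p' pp' up' sub'] := shortenP pw => lp'.
have sp' : size p' <= k.+2.
  have -> : k.+2 = size (x :: rcons q v) by rewrite /= size_rcons sq.
  by apply: uniq_leq_size => //; case/andP: up'.
have loopless a r : path e'' a r -> uniq (a :: r) -> path (Defs.induced e S) a r.
  elim: r a => //= y r IH a /andP[/and3P[aS yS ay] yr] /andP[ayr uyr].
  rewrite IH // andbT; apply/and3P; split=> //.
  by move: ay ayr; rewrite inE negb_or /reflcl /= => /orP[/eqP->|//]; rewrite eqxx.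
have ip : is_path (Defs.induced e S) u v p'.
  by rewrite /is_path up' lp' eqxx !andbT; exact: loopless.
have := mG_le ip; case: mG => //= d le_d; apply: leq_trans le_d _.
by rewrite -subn1 leq_subLR add1n.
Qed.

(** A diagonal pair is covered by standing still at a vertex of [D] equal or adjacent to [u]. For a
    target couple, the internal vertices of a short path form the walk, padded by repeating the last
    one. *)
Lemma feasible_covered k D p :
  feasible k.+1 e D -> p \in required -> walk_covered k D p.
Proof.
case: p => u v [dom cov] reqp; have [uv|uv] := eqVneq u v.
  subst v; have [y yD uy] : exists2 y, y \in D & reflcl u y.
    have [uD|/dom[y yD uy]] := boolP (u \in D); first by exists u; rewrite /reflcl /= ?eqxx.
    by exists y => //; exact: sub_reflcl.
  exists y, (nseq k y); split; rewrite ?size_nseq ?reflcl_path_nseq //=.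
    by rewrite yD all_nseq /= yD orbT.
  by rewrite inE last_nseq /= uy reflcl_sym.
have tc : target_couple e u v by apply/target_coupleP.
have [p /and3P[pp up /eqP lp] sp] := mG_le_path (cov _ _ tc).
have nuv : ~~ e u v.
  by move: reqp; rewrite inE /= (negbTE uv) => /existsP[? /and3P[]].
case/lastP: p => [|q v'] in pp up lp sp *; first by rewrite -lp eqxx in uv.
rewrite last_rcons in lp; subst v'.
have epp : path e u (rcons q v) by apply: sub_path pp => a b /and3P[].
have Sq : all (mem (D :|: [set u; v])) (rcons q v) by exact: induced_path pp.
(* As [u] and [v] are not adjacent, the path has an internal vertex. *)
case: q => [|x q] in pp up sp epp Sq *; first by rewrite /= andbT (negbTE nuv) in epp.
move: epp; rewrite rcons_cons /= rcons_path => /and3P[ux xq qv].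
(* The path has no repetition, so its internal vertices differ from [u] and [v] and must lie in
   [D]. *)
have Dq : all (mem D) (x :: q).
  apply/allP => y yq; have := allP Sq y; rewrite mem_rcons in_cons yq orbT => /(_ isT).
  rewrite !inE => /or3P[//|/eqP E|/eqP E]; subst y; move: up.
    by rewrite cons_uniq mem_rcons in_cons yq orbT.
  by rewrite cons_uniq rcons_uniq yq !andbF.
rewrite rcons_cons /= size_rcons in sp.
exists x, (q ++ nseq (k - size q) (last x q)); split.
- by rewrite size_cat size_nseq; lia.
- by rewrite cat_path reflcl_path_nseq andbT; apply: sub_path xq; exact: sub_reflcl.
- have lq : last x q \in D by apply: (allP Dq); exact: mem_last.
  by rewrite -cat_cons all_cat Dq all_nseq /= lq orbT.
- by rewrite inE /= last_cat last_nseq /reflcl /= ux qv !orbT.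
Qed.

(** A walk standing still in the intersection of the two closed neighbourhoods reaches the pair.
    Hence a threshold of 0 can leave nothing uncovered. *)
Lemma required_walk k p :
  p \in required -> exists x q, [/\ size q = k, path reflcl x q & p \in reach x q].
Proof.
case: p => u v reqp; have [y uy yv] : exists2 y, reflcl u y & reflcl y v.
  move: reqp; rewrite inE => /= /orP[/eqP->|/existsP[y /and3P[uy yv _]]].
    by exists v; rewrite /reflcl /= eqxx.
  by exists y; exact: sub_reflcl.
by exists y, (nseq k y); rewrite size_nseq reflcl_path_nseq inE last_nseq /= uy yv.
Qed.

Lemma feasible_nonempty k D : 0 < #|V| -> feasible k e D -> 0 < #|D|.
Proof.
case/card_gt0P => x _ [dom _]; have [xD|/dom[y yD _]] := boolP (x \in D);
  by apply/card_gt0P; eexists; eassumption.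
Qed.

(* The only consequence of "some m walks reach every required pair" that the
   greedy argument uses. *)
Definition walk_dense (k m : nat) : Prop :=
  forall U K, U \subset required ->
    (forall x q, size q = k -> path reflcl x q -> #|reach x q :&: U| <= K) ->
    #|U| <= m * K.

(** There are [#|D| ^ k.+1] sequences of [k.+1] vertices of [D]; those that are walks cover all of
    [U], each accounting for at most [K] pairs. *)
Lemma feasible_dense k D : feasible k.+1 e D -> walk_dense k (#|D| ^ k.+1).
Proof.
move=> feasD U K subU small.
pose W := (k.+1.-tuple {x | x \in D})%type.
(* A sequence that is not a walk contributes nothing, which allows summing over all tuples. *)
pose R (w : W) := let: s := map val w in
  if s is x :: q then (if path reflcl x q then reach x q :&: U else finset.set0) else
    finset.set0.
have RK w : #|R w| <= K.
  rewrite /R; have := size_tuple w; case: (tval w) => [|x q] //= [sq].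
  by case: ifP => pq; rewrite ?cards0 //; apply: small => //; rewrite size_map.
have sub : U \subset \bigcup_w R w.
  apply/fintype.subsetP => p pU.
  have [x [q [sq pq Dq pR]]] := feasible_covered feasD (fintype.subsetP subU _ pU).
  have Ex : exists l : seq {x | x \in D}, map val l = x :: q.
    elim: (x :: q) Dq => [|a l IH] /=; first by exists [::].
    by case/andP=> aD /IH[l' <-]; exists (exist _ a aD :: l').
  have [l lE] := Ex; have sl : size l == k.+1 by rewrite -(size_map val) lE /= sq.
  by apply/finset.bigcupP; exists (Tuple sl) => //; rewrite /R /= lE pq inE pR.
apply: leq_trans (subset_leq_card sub) _.
have -> : #|D| ^ k.+1 * K = \sum_(w : W) K.
  by rewrite sum_nat_const card_tuple card_sig.
apply: (@leq_trans (\sum_(w : W) #|R w|)); last by apply: leq_sum.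
elim/big_rec2: _ => [|w a B _ IH]; first by rewrite cards0.
by apply: leq_trans (leq_card_setU _ _) _; rewrite leq_add2l.
Qed.

End Requirements.

(** * The greedy invariant *)

Section Harmonic.
Variable R : realType.
Local Open Scope ring_scope.

Definition harm (n : nat) : R := \sum_(i < n) i.+1%:R^-1.

(** Each of the [a - b] terms of the difference is at least [1 / a]. *)
Lemma harm_sub (a b : nat) : (b <= a)%N -> (0 < a)%N ->
  (a - b)%N%:R / a%:R <= harm a - harm b.
Proof.
move=> le_ba a0; have -> : harm a - harm b = \sum_(b <= i < a) i.+1%:R^-1.
  rewrite /harm -!(big_mkord xpredT (fun i => i.+1%:R^-1)).
  by rewrite (big_cat_nat (leq0n b) le_ba) /= addrAC subrr add0r.
have -> : (a - b)%N%:R / a%:R = \sum_(b <= i < a) (a%:R^-1 : R).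
  by rewrite sumr_const_nat mulr_natl.
apply: ler_sum_nat => i /andP[_ ia].
by rewrite lef_pV2 ?posrE ?ltr0n // ler_nat.
Qed.

(** The last term [x] satisfies [x <= - ln (1 - x)], and [1 - x] is a quotient of consecutive
    integers, so the logarithms telescope. *)
Lemma harm_le_ln (n : nat) : (0 < n)%N -> harm n <= 1 + ln n%:R.
Proof.
elim: n => // -[|n] IH _; first by rewrite /harm big_ord1 ln1 addr0 invr1.
rewrite /harm big_ord_recr /= -/(harm n.+1).
have := IH isT; set h := harm _; set x := n.+2%:R^-1.
suff : x <= ln n.+2%:R - ln n.+1%:R by lra.
have n1 : 0 < n.+1%:R :> R by rewrite ltr0n.
have n2 : 0 < n.+2%:R :> R by rewrite ltr0n.
have E : n.+1%:R = n.+2%:R * (1 + - x) :> R.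
  by rewrite mulrDr mulr1 mulrN /x divff ?gt_eqF // -[n.+2%:R]natr1 addrK.
have x1 : x < 1 by rewrite invf_lt1 // ltr1n.
rewrite [in ln n.+1%:R]E lnM ?posrE //; last by lra.
have : ln (1 + - x) <= - x by apply: le_ln1Dx; lra.
lra.
Qed.

Lemma harm_mono (a b : nat) : (b <= a)%N -> harm b <= harm a.
Proof.
move=> le_ba; case: (posnP a) => [a0|a0]; first by move: le_ba; rewrite a0 leqn0 => /eqP->.
by rewrite -subr_ge0; apply: le_trans (harm_sub le_ba a0); rewrite divr_ge0.
Qed.

End Harmonic.

Section Greedy.

Variables (R : realType) (V : finType) (e : rel V) (k : nat).
Hypothesis e_simple : simple_graph e.
Implicit Types (D : {set V}) (U : {set V * V}) (x : V) (q : seq V) (K : nat).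

(** [U] holds the pairs still uncovered and [c] counts selections, each adding at most [k.+1]
    vertices. The last inequality is a potential argument: a selection is paid by the drop of
    [m * harm #|U|]. It is stated for every [m] because the algorithm does not know the optimum. *)
Definition greedy_inv K D U : Prop :=
  [/\ U \subset required e,
      forall p, p \in required e -> p \in U \/ walk_covered e k D p,
      forall x q, size q = k -> path (reflcl e) x q -> #|reach e x q :&: U| <= K &
      exists c : nat, #|D| <= k.+1 * c /\ forall m, walk_dense e k m ->
        (c%:R + m%:R * harm R #|U| <= m%:R * harm R #|required e|)%R].

Lemma greedy_init K : #|V| * #|V| <= K -> greedy_inv K finset.set0 (required e).
Proof.
move=> le_K; split=> //; first by left.
  move=> x q _ _; apply: leq_trans le_K; rewrite -card_prod; exact: max_card.
by exists 0; rewrite cards0; split=> // m _; rewrite add0r.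
Qed.

Lemma greedy_lower K D U :
  (forall x q, size q = k -> path (reflcl e) x q -> #|reach e x q :&: U| < K.+1) ->
  greedy_inv K.+1 D U -> greedy_inv K D U.
Proof. by move=> small [sub cov _ cost]; split. Qed.

(** Density gives [#|U| <= m * K], and at least [K] pairs leave [U], so [m] times the fraction
    removed is at least 1. By [harm_sub] the potential drops by at least 1, paying for the new
    selection. *)
Lemma greedy_step K D U x q :
  size q = k -> path (reflcl e) x q -> 0 < K -> K <= #|reach e x q :&: U| ->
  greedy_inv K D U ->
  greedy_inv K (D :|: [set y in x :: q]) (U :\: reach e x q).
Proof.
move=> sq pq K0 leK [sub cov small [c [cD cost]]].
have covS D' p : D \subset D' -> walk_covered e k D p -> walk_covered e k D' p.
  move=> sD [y [r [sr pr Dr yr]]]; exists y, r; split=> //.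
  by apply/allP => z /(allP Dr)/(fintype.subsetP sD).
have DS : D \subset D :|: [set y in x :: q] by exact: finset.subsetUl.
split.
- by apply: fintype.subset_trans sub; exact: finset.subsetDl.
- move=> p /cov[pU|pD]; last by right; apply: covS pD.
  have [pr|pr] := boolP (p \in reach e x q); last by left; rewrite inE pr.
  right; exists x, q; split=> //; apply/allP => z zq.
  by rewrite /= inE; apply/orP; right; rewrite inE.
- move=> y r sr pr; apply: leq_trans (small y r sr pr).
  by apply: subset_leq_card; apply: finset.setIS; exact: finset.subsetDl.
exists c.+1; split.
  apply: leq_trans (leq_card_setU _ _) _; rewrite mulnS addnC leq_add //.
  by rewrite cardsE; apply: leq_trans (card_size _) _; rewrite /= sq.
move=> m dm; have := cost m dm; have := dm U K sub small.
have := cardsID (reach e x q) U; rewrite finset.setIC.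
set r := #|reach e x q :&: U|; set b := #|U :\: _|; set a := #|U| => Ea le_am.
have a0 : 0 < a by lia.
have le_ba : b <= a by lia.
have H := harm_sub R le_ba a0.
suff : (1 <= m%:R * (harm R a - harm R b))%R.
  by rewrite -natr1 mulrBr => ? ?; lra.
apply: le_trans (ler_wpM2l (ler0n _ m) H).
rewrite mulrA ler_pdivlMr ?ltr0n // mul1r -natrM ler_nat.
by apply: leq_trans le_am _; rewrite leq_mul2l; apply/orP; right; lia.
Qed.

(** With threshold 0 no walk reaches a pair of [U], yet every required pair is reached by some walk,
    so [U] is empty. *)
Lemma greedy_done D U : greedy_inv 0 D U ->
  feasible k.+1 e D /\ exists c : nat, #|D| <= k.+1 * c /\
    forall m, walk_dense e k m -> (c%:R <= m%:R * harm R #|required e|)%R.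
Proof.
case=> sub cov small [c [cD cost]].
have U0 : U = finset.set0.
  apply/setP=> p; rewrite inE; apply/negP => pU.
  have [x [q [sq pq pr]]] := required_walk k (fintype.subsetP sub _ pU).
  have := small x q sq pq; rewrite leqn0 cards_eq0 => /eqP/setP/(_ p).
  by rewrite !inE pU andbT; move: pr; rewrite inE => ->.
split.
  by apply: covered_feasible => // p /cov[]//; rewrite U0 inE.
exists c; split=> // m dm; have := cost m dm.
by rewrite U0 cards0 /harm big_ord0 mulr0 addr0.
Qed.

End Greedy.

(** * The program *)

Section Memory.

Variable n : nat.
Implicit Types (m : nat -> nat) (i j a b : 'I_n).

Definition adj m : rel 'I_n := fun i j => m (i * n + j) != 0.
Definition outs m : {set 'I_n} := [set i : 'I_n | m (n * n + i) != 0].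
Definition unc m : {set 'I_n * 'I_n} :=
  [set p : 'I_n * 'I_n | m (n * n + n + (p.1 * n + p.2)) != 0].

Lemma cell_lt i j : i * n + j < n * n.
Proof. by have := ltn_ord i; have := ltn_ord j; nia. Qed.

Lemma cell_eq i j a b : (i * n + j == a * n + b) = ((i, j) == (a, b)).
Proof.
apply/eqP/eqP => [E|[-> ->] //].
have n0 : 0 < n by apply: leq_trans (ltn_ord i).
have Ei : i = a :> nat.
  have : (i * n + j) %/ n = (a * n + b) %/ n by rewrite E.
  by rewrite !divnMDl // !divn_small ?addn0.
by congr pair; apply: val_inj => //=; move: E; rewrite Ei => /addnI.
Qed.

Lemma adj_upd_adj m a b k :
  adj (upd m (a * n + b) k) =2 fun i j => if (i, j) == (a, b) then k != 0 else adj m i j.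
Proof. by move=> i j; rewrite /adj /upd cell_eq; case: ifP. Qed.

Lemma adj_upd m x k : n * n <= x -> adj (upd m x k) =2 adj m.
Proof.
by move=> x_ge i j; rewrite /adj /upd ifN //; apply: contraTneq x_ge => <-;
  rewrite -ltnNge cell_lt.
Qed.

Lemma outs_upd_outs m a k :
  outs (upd m (n * n + a) k) = if k != 0 then a |: outs m else outs m :\ a.
Proof.
by apply/setP=> i; case: ifP => k0; rewrite !inE /upd eqn_add2l -val_eqE; case: ifP;
  rewrite ?k0.
Qed.

Lemma outs_upd m x k : (x < n * n) || (n * n + n <= x) -> outs (upd m x k) = outs m.
Proof.
by move=> xb; apply/setP=> i; rewrite !inE /upd ifN //; have := ltn_ord i;
  apply/contraTneq; lia.
Qed.

Lemma unc_upd_unc m a b k :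
  unc (upd m (n * n + n + (a * n + b)) k) =
  if k != 0 then (a, b) |: unc m else unc m :\ (a, b).
Proof.
apply/setP=> -[i j]; case: ifP => k0; rewrite !inE /upd eqn_add2l cell_eq -pair_eqE;
  by case: ifP; rewrite ?k0.
Qed.

Lemma unc_upd m x k : x < n * n + n -> unc (upd m x k) = unc m.
Proof. by move=> xb; apply/setP=> -[i j]; rewrite !inE /upd /= ifN //; apply/eqP; lia. Qed.

End Memory.

(** Visits the pairs whose first entry is related to the vertex in [x0] and to whose second entry
    the vertex in [xl] is related. When the matrix holds [reflcl e] and the registers hold the ends
    of a walk, this is its [reach]. *)
Definition rect (x0 xl : nat) (c : prog) : prog :=
  For 8 (Seq (Add 3 9 x0) (Seq (Read 3 3) (If 3
    (For 10 (Seq (Add 3 xl.+1 10) (Seq (Read 3 3) (If 3 c Skip)))) Skip))).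

Definition rectT (n T : nat) : nat := forT n (forT n T.+3).+3.

Lemma mods_rect x0 xl c r :
  (r \in mods (rect x0 xl c)) = (r \in [:: 2; 3; 8; 9; 10; 11]) || (r \in mods c).
Proof.
rewrite /= !(mem_cat, inE) /=; case: (r \in mods c); rewrite ?orbT //.
by move: (r == 2) (r == 3) (r == 8) (r == 9) (r == 10) (r == 11); do 6!case.
Qed.

(** The body may write to memory, so [J] must entail that the matrix still represents [A], which the
    later tests read. *)
Lemma ens_rect (X : Type) (idx : X) (op : Monoid.com_law idx) n x0 xl c T
    (A : rel 'I_n) (J : X -> nat -> (nat -> nat) -> Prop) (F : 'I_n -> 'I_n -> X)
    (a b : 'I_n) y s :
  reg s 0 = n -> reg s 1 = 1 -> reg s x0 = a -> reg s xl.+1 = b * n ->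
  x0 \notin mods (rect x0 xl c) -> xl.+1 \notin mods (rect x0 xl c) ->
  all (fun r => r \notin mods c) [:: 0; 1; 8; 9; 10; 11] -> 0 < T ->
  (forall y' k m, J y' k m -> adj m =2 A) ->
  (forall u v s1 y', A u a -> A b v ->
     (forall r, r \notin mods (rect x0 xl c) -> reg s1 r = reg s r) ->
     reg s1 8 = u -> reg s1 9 = u * n -> reg s1 10 = v ->
     J y' (reg s1 7) (Defs.mem s1) ->
     ens c s1 T (fun s2 => J (op y' (F u v)) (reg s2 7) (Defs.mem s2))) ->
  J y (reg s 7) (Defs.mem s) ->
  ens (rect x0 xl c) s (rectT n T) (fun s' =>
    (forall r, r \notin mods (rect x0 xl c) -> reg s' r = reg s r) /\
    J (op y (\big[op/idx]_(p : 'I_n * 'I_n | A p.1 a && A b p.2) F p.1 p.2))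
      (reg s' 7) (Defs.mem s')).
Proof.
move=> s0 s1 sx sl x0r xlr /and5P[c0 c1 c8 c9 /and3P[c10 c11 _]] T0 JA step Jy.
have notL r : r \notin mods (rect x0 xl c) ->
    [/\ r != 2, r != 3, r != 8, r != 9 & [&& r != 10, r != 11 & r \notin mods c]].
  by rewrite mods_rect !inE !negb_or -!andbA => /and5P[-> -> -> -> /and3P[-> -> ->]].
have [x02 x03 x08 x09 _] := notL _ x0r.
have [xl2 xl3 xl8 xl9 /and3P[xl10 xl11 xlc]] := notL _ xlr.
(* Failed tests contribute the neutral element, which turns the filtered operation over pairs into
   two nested unfiltered ones. *)
pose F1 u v := if A b v then F u v else idx.
pose F2 u := if A u a then \big[op/idx]_v F1 u v else idx.
have -> : \big[op/idx]_(p : 'I_n * 'I_n | A p.1 a && A b p.2) F p.1 p.2 = \big[op/idx]_u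
  F2 u.
  rewrite -(pair_big_dep (fun u => A u a) (fun _ v => A b v) F) big_mkcond.
  by apply: eq_bigr => u _; rewrite /F2; case: ifP => // _; rewrite big_mkcond.
apply: ens_for_big => //; first by rewrite /loop_ok /= !(mem_cat, inE) /= ?orbF c0 c1 c8 c9.
move=> u s2 y1 fr2 u8 u9 J1.
have Ex0 : reg s2 x0 = a by rewrite fr2.
have Eua : (Defs.mem s2 (u * n + a) != 0) = A u a := JA _ _ _ J1 u a.
apply/ens_seq1/ens_add/ens_seq1/ens_read/ens_if; rewrite /= /upd /= u9 Ex0; last first.
  move/eqP; rewrite -[_ == 0]negbK Eua => /negbTE nua.
  by apply: ens_skip; rewrite ?/forT ?addn4 //= /F2 nua Monoid.mulm1.
rewrite Eua => ua; rewrite /F2 ua.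
set s3 := set_reg _ 3 _.
have fr3 r : r \notin mods (rect x0 xl c) -> reg s3 r = reg s r.
  by move=> rL; have [_ /negbTE r3 _ _ _] := notL _ rL; rewrite /= /upd r3 fr2.
have rl0 : 0 \notin mods (rect x0 xl c) by rewrite mods_rect.
have rl1 : 1 \notin mods (rect x0 xl c) by rewrite mods_rect.
have fr4 r s4 : (forall r, r \notin mods (For 10 (Seq (Add 3 xl.+1 10) (Seq (Read 3 3)
  (If 3 c Skip)))) ->
    reg s4 r = reg s3 r) -> (r \notin mods (rect x0 xl c)) || (r \in [:: 8; 9]) ->
      reg s4 r = reg s3 r.
  move=> h rL; apply: h; rewrite /= !(mem_cat, inE) /= !orbF; case/orP: rL =>
    [/notL[r2 r3 _ _ /and3P[r10 r11 rc]]|].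
    by rewrite !negb_or r2 r3 r10 r11 rc.
  by rewrite !inE => /orP[]/eqP-> /=; rewrite orbF.
apply: ens_weaken (leqnn _) _ (ens_for_big (op := op) (J := J) (F := F1 u) (y :=
  y1) _ _ _ _ _) => //.
- by move=> s' [_].
- by rewrite fr3.
- by rewrite fr3.
- by rewrite /loop_ok /= !(mem_cat, inE) /= ?orbF c0 c1 c10 c11.
move=> v s4 y2 /fr4 h v10 v11 J4.
have Exl : reg s4 xl.+1 = b * n by rewrite h ?xlr // fr3.
have Ebv : (Defs.mem s4 (b * n + v) != 0) = A b v := JA _ _ _ J4 b v.
apply/ens_seq1/ens_add/ens_seq1/ens_read/ens_if; rewrite /= /upd /= Exl v10; last first.
  move/eqP; rewrite -[_ == 0]negbK Ebv => /negbTE nbv.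
  by apply: ens_skip; rewrite //= /F1 nbv Monoid.mulm1.
rewrite Ebv => bv; rewrite /F1 bv; apply: step => //=.
- move=> r rL; have [_ /negbTE r3 _ _ _] := notL _ rL.
  by rewrite /upd r3 h ?rL // fr3.
- by rewrite /upd /= h //= /upd /= u8.
- by rewrite /upd /= h //= /upd /= u9.
Qed.

(* The register of the i-th vertex of the current walk; registers below 20 are
   reserved. *)
Local Notation W i := (i.*2.+4.+4.+4.+4.+4).

Lemma updE f a k b : upd f a k b = if b == a then k else f b.
Proof. by []. Qed.

(** * Testing one walk and enumerating all walks *)

Definition count_pair : prog :=
  Seq (Add 3 9 10) (Seq (Add 3 3 5) (Seq (Read 3 3) (If 3 (Add 7 7 1) Skip))).

Definition delete_pair : prog :=
  Seq (Add 3 9 10) (Seq (Add 3 3 5) (Write 3 14)).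

Fixpoint output_walk (k : nat) : prog :=
  if k is k'.+1 then Seq (output_walk k') (Seq (Add 3 4 (W k')) (Write 3 1)) else Skip.

(** Truncated subtraction leaves 0 in register 3 exactly when the count reaches the threshold, so
    the nonzero branch rejects the walk. *)
Definition try_walk (k : nat) : prog :=
  Seq (Const 7 0) (Seq (rect (W 0) (W k) count_pair)
    (Seq (Defs.Sub 3 6 7)
      (If 3 Skip (Seq (output_walk k.+1) (rect (W 0) (W k) delete_pair))))).

(** [k] vertices remain to be chosen, the next one at position [i]. The nesting depth is fixed in
    the program text, so a constant alpha gives polynomial time. *)
Fixpoint extend_walk (c : prog) (k i : nat) : prog :=
  if k is k'.+1 then
    For (W i) (Seq (Add 3 (W i.-1).+1 (W i)) (Seq (Read 3 3)
      (If 3 (extend_walk c k' i.+1) Skip)))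
  else c.

Definition all_walks (k : nat) : prog := For (W 0) (extend_walk (try_walk k) k 1).

Definition consts (n K : nat) (r : nat -> nat) : Prop :=
  [/\ r 0 = n, r 1 = 1, r 4 = n * n, r 5 = n * n + n & r 6 = K /\ r 14 = 0].

Lemma consts_frame n K (r r' : nat -> nat) (L : seq nat) :
  (forall x, x \notin L -> r' x = r x) ->
  all (fun x => x \notin L) [:: 0; 1; 4; 5; 6; 14] -> consts n K r -> consts n K r'.
Proof.
move=> fr /and5P[l0 l1 l4 l5 /and3P[l6 l14 _]] [r0 r1 r4 r5 [r6 r14]].
by split; rewrite ?fr //; split; rewrite fr.
Qed.

Definition holds_walk n (w : seq 'I_n) (s : state) : Prop :=
  forall j, j < size w -> reg s (W j) = nth 0 (map val w) j /\
                          reg s (W j).+1 = nth 0 (map val w) j * n.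

Lemma holds_walk_frame n (w : seq 'I_n) s s' :
  (forall j, j < size w ->
    reg s' (W j) = reg s (W j) /\ reg s' (W j).+1 = reg s (W j).+1) ->
  holds_walk w s -> holds_walk w s'.
Proof. by move=> fr h j jw; have [-> ->] := fr j jw; exact: h. Qed.

Lemma mods_output_walk k r : r \in mods (output_walk k) -> r = 3.
Proof. by elim: k => //= k IH; rewrite mem_cat inE => /orP[/IH//|/eqP]. Qed.

Lemma ens_output_walk n K k (w : seq 'I_n) s :
  k <= size w -> consts n K (reg s) -> holds_walk w s ->
  ens (output_walk k) s (k.*2.+1) (fun s' =>
    [/\ (forall r, r \notin [:: 3] -> reg s' r = reg s r),
        adj (n := n) (Defs.mem s') =2 adj (Defs.mem s),
        outs n (Defs.mem s') = outs n (Defs.mem s) :|: [set y in take k w] &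
        unc n (Defs.mem s') = unc n (Defs.mem s)]).
Proof.
elim: k => [|k IH] kw cs hs.
  apply: ens_skip => //; split=> //; rewrite take0; apply/setP => y.
  by rewrite !inE orbF.
have -> : k.+1.*2.+1 = k.*2.+1 + 2 by lia.
apply/ens_seq/(ens_weaken (leqnn _) _ (IH (ltnW kw) cs hs)) => s1 [fr1 A1 O1 U1].
apply/ens_seq1/ens_add/ens_write; rewrite /= /upd /=.
have [_ c1 c4 _ _] := cs.
case: w {IH} => [//|a w'] in kw hs O1 *; set w := a :: w'.
have [hk _] := hs k kw.
rewrite !fr1 ?inE // c1 c4 hk (nth_map a) //; split.
- by move=> r r3; rewrite /upd ifN ?fr1 //; rewrite inE in r3.
- by move=> i j; rewrite (adj_upd _ _ (leq_addr _ _)) A1.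
- rewrite outs_upd_outs O1 (take_nth a) // (_ : 1 != 0) //.
  by apply/setP=> y; rewrite !inE mem_rcons inE orbCA.
- by rewrite unc_upd ?U1 // ltn_add2l ltn_ord.
Qed.

Lemma reach_adj n (e : rel 'I_n) x q (p : 'I_n * 'I_n) :
  (p \in reach e x q) = reflcl e p.1 x && reflcl e (last x q) p.2.
Proof. by rewrite inE. Qed.

Section TryWalk.

Variables (n k K : nat) (e : rel 'I_n).
Implicit Types (m : nat -> nat).

Definition tryT (k n : nat) : nat := (rectT n 5 + (k.+1.*2.+1 + rectT n 3).+2).+1.

Lemma ens_try_walk x q s :
  size q = k -> consts n K (reg s) -> holds_walk (x :: q) s ->
  adj (Defs.mem s) =2 reflcl e ->
  ens (try_walk k) s (tryT k n) (fun s' => let m := Defs.mem s in let m' := Defs.mem s' in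
    #|reach e x q :&: unc n m| < K /\ m' = m \/
    K <= #|reach e x q :&: unc n m| /\
    [/\ adj m' =2 reflcl e, outs n m' = outs n m :|: [set y in x :: q] &
        unc n m' = unc n m :\: reach e x q]).
Proof.
move=> sq cs hs As.
have [c0 c1 c4 c5 [c6 c14]] := cs.
have [h0 _] := hs 0 isT; rewrite /= in h0.
have szk : k < size (x :: q) by rewrite /= sq.
have hk : reg s (W k).+1 = last x q * n.
  by have [_ ->] := hs k szk; rewrite (last_nth x) sq (nth_map x).
set m := Defs.mem s; rewrite /try_walk /tryT.
apply/ens_seq1/ens_const.
apply: ens_seq.
(* First sweep: the accumulator counts uncovered pairs and the memory stays unchanged. *)
pose J1 (y c : nat) m' := c = y /\ m' = m.
pose F1 (u v : 'I_n) : nat := (u, v) \in unc n m.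
have step1 := @ens_rect nat 0 addn n (W 0) (W k) count_pair 5 (reflcl e) J1 F1 x (last x
  q) 0
   (set_reg s 7 0).
apply: ens_weaken (leqnn _) _ (step1 _ _ _ _ _ _ _ _ _ _ _) => //; last first.
- move=> u v s1 y' ux qv fr u8 u9 v10 [E7 Em].
  have u5 : reg s1 5 = n * n + n by rewrite fr.
  have u1 : reg s1 1 = 1 by rewrite fr.
  apply/ens_seq1/ens_add/ens_seq1/ens_add/ens_seq1/ens_read/ens_if;
    rewrite /= /upd /= u9 v10 u5 Em addnC.
    move=> uv; apply: ens_add; rewrite /J1 /= /upd /= E7 u1; split=> //.
    by rewrite /F1 inE uv.
  move=> uv; apply: ens_skip => //; rewrite /J1 /= /upd /= E7; split=> //.
  by rewrite /F1 inE uv addn0.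
- by move=> y' c m' [_ ->].
move=> s1 [fr1 [E7 Em]].
have {}E7 : reg s1 7 = #|reach e x q :&: unc n m|.
  rewrite E7 Monoid.mul1m -sum1_card [LHS]big_mkcond [RHS]big_mkcond.
  by apply: eq_bigr => -[u v] _; rewrite /F1 finset.in_setI reach_adj /=; case: ifP =>
    //= _; case: (_ \in _).
have fr1' r : r \notin [:: 2; 3; 7; 8; 9; 10; 11] -> reg s1 r = reg s r.
  move=> rL; have r7 : r != 7 by apply: contraNneq rL => ->.
  rewrite fr1 ; first by rewrite /= /upd (negbTE r7).
  by apply: contraNN rL; rewrite mods_rect !inE; do !case: eqP => //.
apply/ens_seq1/ens_sub/ens_if; rewrite /= /upd /= E7 fr1' // c6.
  by rewrite subn_eq0 -ltnNge => lt; apply: ens_skip; [lia|left].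
move/eqP; rewrite subn_eq0 => leK; apply: ens_seq.
set s2 := set_reg s1 3 _.
have fr2 r : r \notin [:: 2; 3; 7; 8; 9; 10; 11] -> reg s2 r = reg s r.
  by move=> rL; rewrite /= /upd ifN ?fr1' //; apply: contraNneq rL => ->.
have cs2 : consts n K (reg s2) by apply: consts_frame fr2 _ cs.
have hs2 : holds_walk (x :: q) s2.
  by apply: holds_walk_frame hs => j _; split; apply: fr2.
have szk1 : k.+1 <= size (x :: q) by rewrite /= sq.
apply: ens_weaken (leqnn _) _ (ens_output_walk szk1 cs2 hs2) => s3 [fr3 A3 O3 U3].
have m2 : Defs.mem s2 = m by rewrite /= Em.
rewrite m2 in A3 O3 U3; rewrite take_oversize ?szk1 /= ?sq // in O3.
have fr3' r : r \notin [:: 2; 3; 7; 8; 9; 10; 11] -> reg s3 r = reg s r.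
  by move=> rL; rewrite fr3 ?fr2 //; apply: contraNN rL; rewrite !inE => /eqP->.
(* Second sweep: [Y] gathers the deleted pairs and ends as [reach e x q]. *)
pose J2 (Y : {set 'I_n * 'I_n}) (c : nat) m' :=
  [/\ adj m' =2 reflcl e, outs n m' = outs n m :|: [set y in x :: q] &
    unc n m' = unc n m :\: Y].
pose F2 (u v : 'I_n) := [set (u, v)].
have step2 := @ens_rect _ finset.set0 (@finset.setU _) n (W 0) (W k) delete_pair 3
  (reflcl e) J2 F2 x (last x q)
  finset.set0 s3.
apply: ens_weaken (leqnn _) _ (step2 _ _ _ _ _ _ _ _ _ _ _) => //; try by rewrite fr3'.
- move=> s' [_ [A4 O4 U4]]; right; split=> //; split=> //.
  rewrite U4; congr (_ :\: _); apply/setP => p; rewrite Monoid.mul1m reach_adj.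
  apply/finset.bigcupP/idP => [[[u v] uv]|uv]; first by rewrite inE => /eqP->.
  by exists p => //; rewrite inE -surjective_pairing.
- by move=> Y c m' [].
- move=> u v s4 Y ux qv fr4 u8 u9 v10 [A4 O4 U4].
  have u5 : reg s4 5 = n * n + n by rewrite fr4 // fr3'.
  have u14 : reg s4 14 = 0 by rewrite fr4 // fr3'.
  apply/ens_seq1/ens_add/ens_seq1/ens_add/ens_write.
  rewrite /= !updE /= ?updE /= u9 v10 u5 u14 [u * n + v + _]addnC.
  split.
  + by move=> i j; rewrite adj_upd ?A4 // -addnA leq_addr.
  + by rewrite outs_upd ?O4 // -[n * n + n + _]addnA orbC leq_add2l leq_addr.
  + by rewrite unc_upd_unc /= U4; apply/setP => p; rewrite /F2 !inE; case: (p \in Y);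
    case: (p == _).
split=> //; first by move=> i j; rewrite A3 -As.
by rewrite U3 finset.setD0.
Qed.

End TryWalk.

Lemma mods_try_walk k r : r \in mods (try_walk k) -> r \in [:: 2; 3; 7; 8; 9; 10; 11].
Proof.
have [->//|r3] := r =P 3.
have no3 : (r \in mods (output_walk k)) = false by apply/negP => /mods_output_walk.
rewrite /try_walk /= !(mem_cat, inE) no3.
by do !case: (r == _) => //=.
Qed.

(** Apart from scratch registers and those of [c], deeper loops write only from [W i] on, so the
    part of the walk already chosen survives. *)
Lemma mods_extend_walk c j i r :
  r \in mods (extend_walk c j i) -> [|| r \in [:: 2; 3], W i <= r | r \in mods c].
Proof.
elim: j i => [|j IH] i; first by move=> /= ->; rewrite !orbT.
have [->|ri] := eqVneq r (W i); first by rewrite leqnn !orbT.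
have [->|ri1] := eqVneq r (W i).+1; first by rewrite leqnSn !orbT.
rewrite /= !(mem_cat, inE) (negbTE ri) (negbTE ri1) /= !orbF.
have := IH i.+1; rewrite !inE; case: (r == 2) => //=; case: (r == 3) => //= h.
rewrite orbF => /h /orP[h'|->]; rewrite ?orbT //.
by rewrite (leq_trans _ h') // doubleS; lia.
Qed.

Section Pass.

Variables (R : realType) (n k K : nat) (e : rel 'I_n).
Hypothesis K_gt0 : 0 < K.
Implicit Types (m : nat -> nat).

Definition mem_inv m : Prop :=
  adj m =2 reflcl e /\ greedy_inv R e k K (outs n m) (unc n m).

(** Either the test found fewer than [K] uncovered pairs, or the walk was selected and nothing it
    reaches stays uncovered. *)
Lemma ens_try_walk_inv x q s :
  size q = k -> path (reflcl e) x q -> consts n K (reg s) -> holds_walk (x :: q) s ->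
  mem_inv (Defs.mem s) ->
  ens (try_walk k) s (tryT k n) (fun s' =>
    [/\ mem_inv (Defs.mem s'), unc n (Defs.mem s') \subset unc n (Defs.mem s) &
        #|reach e x q :&: unc n (Defs.mem s')| < K]).
Proof.
move=> sq pq cs hs [As Gs].
apply: ens_weaken (leqnn _) _ (ens_try_walk sq cs hs As) => s' /=.
case=> [[lt ->]|[leK [A' O' U']]] //; split.
- by split=> //; rewrite O' U'; exact: greedy_step.
- by rewrite U'; exact: finset.subsetDl.
rewrite U' (_ : _ :&: _ = finset.set0) ?cards0 //; apply/setP => p.
by rewrite finset.in_setI finset.in_setD finset.in_set0; case: (p \in reach _ _ _).
Qed.

Fixpoint extT (n T j : nat) : nat :=
  if j is j'.+1 then forT n (extT n T j').+3 else T.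

Lemma extT_gt0 T j : 0 < T -> 0 < extT n T j.
Proof. by case: j => //= j _; rewrite /forT addn4. Qed.

(** The uncovered set only shrinks, so an extension once below [K] stays below [K] while later ones
    are processed; at the end this holds for all of them at once. *)
Lemma ens_extend_walk j x q s :
  size q + j = k -> path (reflcl e) x q -> consts n K (reg s) -> holds_walk (x :: q) s ->
  mem_inv (Defs.mem s) ->
  ens (extend_walk (try_walk k) j (size q).+1) s (extT n (tryT k n) j) (fun s' =>
    [/\ mem_inv (Defs.mem s'), unc n (Defs.mem s') \subset unc n (Defs.mem s) &
        forall p, size p = j -> path (reflcl e) (last x q) p ->
          #|reach e x (q ++ p) :&: unc n (Defs.mem s')| < K]).
Proof.
elim: j q s => [|j IH] q s sq pq cs hs Is.
  rewrite addn0 in sq; apply: ens_weaken (leqnn _) _ (ens_try_walk_inv sq pq cs hs Is).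
  by move=> s' [I' U' lt]; split=> // -[] // _ _; rewrite cats0.
have lt1 (U U' S : {set 'I_n * 'I_n}) : U' \subset U -> #|S :&: U| < K -> #|S :&: U'| < K.
  by move=> sU; apply: leq_ltn_trans; apply: subset_leq_card; exact: finset.setIS.
set i := (size q).+1 => /=; set c := Seq _ _.
have mods_c r : r \notin [:: 2; 3; 7; 8; 9; 10; 11] -> r < W i.+1 -> r \notin mods c.
  move=> rL rW; apply: contraNN rL => rc.
  have [->//|r3] := eqVneq r 3.
  have : r \in mods (extend_walk (try_walk k) j i.+1).
    by move: rc; rewrite /c /= !(mem_cat, inE) (negbTE r3) orbF.
  case/mods_extend_walk/or3P => [|h|/mods_try_walk//]; first by rewrite !inE =>
    /orP[]/eqP->.
  by rewrite leqNgt rW in h.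
have mods_F r : r \notin [:: 2; 3; 7; 8; 9; 10; 11] -> r < W i ->
  r \notin mods (For (W i) c).
  move=> rL rW; have rc : r \notin mods c by apply: mods_c => //; rewrite doubleS; lia.
  rewrite mods_For (negbTE rc) orbF !negb_or !neq_ltn rW ltnS (ltnW rW) /=.
  by move: rL; rewrite !inE negb_or neq_ltn => /andP[].
have [c0 c1 _ _ _] := cs.
(* Extensions whose next vertex has index below [l] are done. *)
pose J l (_ : nat) m := [/\ mem_inv m, unc n m \subset unc n (Defs.mem s) &
  forall (y : 'I_n) p, y < l -> size p = j -> path (reflcl e) (last x q) (y :: p) ->
    #|reach e x (q ++ y :: p) :&: unc n m| < K].
have step := @ens_for n (W i) c (extT n (tryT k n) j).+3 J s c0 c1.
apply: ens_weaken (leqnn _) _ (step _ _ _) => {step}.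
- move=> s' [_ [I' U' lt]]; split=> // -[|y p] //= [sp] pp.
  by apply: lt => //; rewrite ltn_ord.
- by rewrite /loop_ok /= !mods_c //; rewrite ?doubleS; lia.
- move=> y s1 fr1 ry ry1 [I1 U1 lt].
  have cs1 : consts n K (reg s1).
    by apply: consts_frame fr1 _ cs; rewrite /= !mods_F.
  have hs1 : holds_walk (x :: rcons q y) s1.
    move=> l; rewrite -rcons_cons size_rcons ltnS leq_eqVlt => /orP[/eqP->|lt_l].
      by rewrite map_rcons nth_rcons size_map ltnn eqxx.
    rewrite map_rcons nth_rcons size_map lt_l.
    have lt2 : l.*2.+1 < i.*2 by rewrite -doubleS leq_double.
    have [<- <-] := hs l lt_l.
    by split; rewrite fr1 // mods_F //; exact: ltnW lt2.
  have rl : reg s1 (W i.-1).+1 = last x q * n.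
    have [|_ ->] := hs1 i.-1; first by rewrite /= size_rcons ltnS.
    rewrite -rcons_cons map_rcons nth_rcons size_map /= leqnn.
    by rewrite -map_cons (nth_map x) // -last_nth.
  have Exy : (Defs.mem s1 (last x q * n + y) != 0) = reflcl e (last x q) y := I1.1 _ _.
  apply/ens_seq1/ens_add/ens_seq1/ens_read/ens_if; rewrite /= !updE /= ?updE /= ry rl;
    last first.
    move/eqP; rewrite -[_ == 0]negbK Exy => /negbTE nxy.
    apply: ens_skip; first by rewrite extT_gt0.
    split=> // z p; rewrite ltnS leq_eqVlt => /orP[/eqP/val_inj->|];
      first by rewrite /= nxy.
    exact: lt.
  rewrite Exy => xy; set s2 := set_reg _ 3 _.
  have cs2 : consts n K (reg s2).
    by apply: (@consts_frame _ _ _ _ [:: 3]) cs1 => // r; rewrite inE /= !updE => /negbTE->.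
  have hs2 : holds_walk (x :: rcons q y) s2.
    by apply: holds_walk_frame hs1 => l _; rewrite /= !updE.
  have := IH (rcons q y) s2; rewrite size_rcons rcons_path pq xy last_rcons.
  move=> /(_ _ isT cs2 hs2 I1); case; first by rewrite -sq addSnnS.
  move=> t [s' [ex le_t [I' U' lt']]]; exists t, s'; split=> //; split=> //.
    exact: fintype.subset_trans U1.
  move=> z p; rewrite ltnS leq_eqVlt => /orP[/eqP/val_inj->|zy] sp pp.
    by rewrite -cat_rcons; apply: lt' => //; case/andP: pp.
  by apply: lt1 U' _; exact: lt.
- by split.
Qed.

(** After a full pass every walk covers fewer than [K] uncovered pairs, which is the invariant for
    the threshold [K.-1]. *)
Lemma ens_all_walks s :
  consts n K (reg s) -> mem_inv (Defs.mem s) ->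
  ens (all_walks k) s (forT n (extT n (tryT k n) k)) (fun s' =>
    [/\ consts n K (reg s'), adj (Defs.mem s') =2 reflcl e &
        greedy_inv R e k K.-1 (outs n (Defs.mem s')) (unc n (Defs.mem s'))]).
Proof.
move=> cs Is; have [c0 c1 _ _ _] := cs.
have mods_c r : r \notin [:: 2; 3; 7; 8; 9; 10; 11] -> r < W 1 ->
    r \notin mods (extend_walk (try_walk k) k 1).
  move=> rL rW; apply: contraNN rL => /mods_extend_walk/or3P[|h|/mods_try_walk//].
    by rewrite !inE => /orP[]/eqP->.
  by rewrite leqNgt rW in h.
pose J l (_ : nat) m := mem_inv m /\
  forall (y : 'I_n) p, y < l -> size p = k -> path (reflcl e) y p ->
    #|reach e y p :&: unc n m| < K.
have step := @ens_for n (W 0) (extend_walk (try_walk k) k 1) (extT n (tryT k n) k) J s c0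
  c1.
apply: ens_weaken (leqnn _) _ (step _ _ _) => {step}.
- move=> s' [fr [[A' G'] lt]]; split=> //.
    by apply: consts_frame fr _ cs; rewrite /= ?mods_For !negb_or /= !mods_c.
  by apply: greedy_lower; rewrite prednK // => y p sp pp; apply: lt.
- by rewrite /loop_ok /= !mods_c.
- move=> y s1 fr1 ry ry1 [I1 lt].
  have cs1 : consts n K (reg s1).
    by apply: consts_frame fr1 _ cs; rewrite /= ?mods_For !negb_or /= !mods_c.
  have hs1 : holds_walk [:: y] s1 by case.
  have := @ens_extend_walk k y [::] s1 erefl isT cs1 hs1 I1.
  apply: ens_weaken (leqnn _) _ => s' [I' U' lt']; split=> // z p.
  rewrite ltnS leq_eqVlt => /orP[/eqP/val_inj->|zy] sp pp; first exact: lt'.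
  apply: leq_ltn_trans (lt z p zy sp pp).
  by apply: subset_leq_card; exact: finset.setIS.
- by split.
Qed.

End Pass.

(** * The complete program: initialisation and descending threshold *)

Definition mark_pair : prog :=
  Seq (Add 3 9 10) (Seq (Read 15 3) (If 15 Skip (Seq (Add 3 3 5) (Write 3 1)))).

(** Besides marking diagonal pairs as uncovered, this puts ones on the diagonal of the matrix,
    replacing [e] by [reflcl e]. *)
Definition mark_diag : prog :=
  Seq (Add 3 9 8) (Seq (Write 3 1) (Seq (Add 3 3 5) (Write 3 1))).

(** The first loop computes [n * n] by repeated addition. Register 14 is never written and keeps its
    initial value 0. *)
Definition greedy_prog (k : nat) : prog :=
  Seq (Const 1 1) (Seq (For 8 (Add 7 7 0)) (Seq (Add 4 7 14) (Seq (Add 5 4 0)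
    (Seq (For 12 (rect 12 12 mark_pair)) (Seq (For 8 mark_diag)
      (Seq (Add 6 4 14) (While 6 (Seq (all_walks k) (Defs.Sub 6 6 1))))))))).

Definition passT (k n : nat) : nat := forT n (extT n (tryT k n) k).

Definition greedyT (k n : nat) : nat :=
  (forT n 1 + (forT n (rectT n 5) +
    (forT n 4 + (n * n * (passT k n + 1).+1).+2)).+2).+1.

Section Program.

Variables (R : realType) (n k : nat) (e : rel 'I_n).
Implicit Types (m : nat -> nat).

Lemma adj_input : adj (Defs.mem (input_state e)) =2 e.
Proof.
move=> i j; rewrite /adj /=; case E: (e i j).
  by rewrite (_ : [exists _, _] = true) //; apply/existsP; exists i; apply/existsP;
    exists j; rewrite eqxx E.
rewrite (_ : [exists _, _] = false) //; apply/existsP => -[a /existsP[b]].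
by rewrite cell_eq => /andP[/eqP[<- <-]]; rewrite E.
Qed.

Lemma input_out x : n * n <= x -> Defs.mem (input_state e) x = 0.
Proof.
move=> lex /=; rewrite (_ : [exists _, _] = false) //; apply/existsP => -[a /existsP[b]].
by case/andP=> /eqP E; move: lex; rewrite E leqNgt cell_lt.
Qed.

(** With both ends at [y], [rect] visits the pairs with common neighbour [y]; the union over [y]
    keeps the nonadjacent ones. *)
Lemma ens_mark_required s :
  consts n 0 (reg s) ->
  adj (Defs.mem s) =2 e -> outs n (Defs.mem s) = finset.set0 ->
    unc n (Defs.mem s) = finset.set0 ->
  ens (For 12 (rect 12 12 mark_pair)) s (forT n (rectT n 5)) (fun s' =>
    [/\ consts n 0 (reg s'), adj (Defs.mem s') =2 e, outs n (Defs.mem s') = finset.set0 &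
        unc n (Defs.mem s') = [set p | [exists y, [&& e p.1 y, e y p.2 & ~~ e p.1 p.2]]]]).
Proof.
move=> cs As Os Us; have [c0 c1 c4 c5 [c6 c14]] := cs.
pose J (Y : {set 'I_n * 'I_n}) (c : nat) m :=
  [/\ adj m =2 e, outs n m = finset.set0 & unc n m = Y].
pose F (u v : 'I_n) : {set 'I_n * 'I_n} := if e u v then finset.set0 else [set (u, v)].
pose F' (y : 'I_n) : {set 'I_n * 'I_n} :=
  \bigcup_(p : 'I_n * 'I_n | e p.1 y && e y p.2) F p.1 p.2.
have step := @ens_for_big _ finset.set0 (@finset.setU _) n 12 (rect 12 12 mark_pair)
  (rectT n 5) J F' finset.set0 s c0 c1 isT.
apply: ens_weaken (leqnn _) _ (step _ _) => {step}.
- move=> s' [fr [A' O' U']]; split=> //; first by apply: consts_frame fr _ cs.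
  rewrite U' Monoid.mul1m; apply/setP => p; rewrite inE.
  apply/finset.bigcupP/existsP =>
    [[y _ /finset.bigcupP[[u v] /= /andP[uy yv]]]|[y /and3P[uy yv nuv]]].
    rewrite /F; case: ifP => [_|nuv]; rewrite inE // => /eqP->.
    by exists y; rewrite /= uy yv nuv.
  exists y => //; apply/finset.bigcupP; exists p; rewrite ?uy //= /F (negbTE nuv) inE.
  by rewrite -surjective_pairing.
- move=> y s1 Y fr1 y12 y13 J1.
  have cs1 : consts n 0 (reg s1) by apply: consts_frame fr1 _ cs.
  have [d0 d1 _ d5 _] := cs1.
  have := @ens_rect _ finset.set0 (@finset.setU _) n 12 12 mark_pair 5 e J F y y Y s1 d0
    d1 y12 y13 isT isT isT isT.
  move=> /(_ _ _ J1) H; apply: ens_weaken (leqnn _) _ (H _ _) => {H}.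
  + by move=> s' [_].
  + by move=> Z c m [].
  + move=> u v s2 Z uy yv fr2 u8 u9 v10 [A2 O2 U2].
    have f1 : reg s2 1 = 1 by rewrite fr2.
    have f5 : reg s2 5 = n * n + n by rewrite fr2.
    have Euv : (Defs.mem s2 (u * n + v) != 0) = e u v := A2 u v.
    apply/ens_seq1/ens_add/ens_seq1/ens_read/ens_if; rewrite /= !updE /= ?updE /= u9 v10.
      rewrite Euv => uv; apply: ens_skip => //; split=> //=.
      by rewrite /F uv Monoid.mulm1.
    move/eqP; rewrite -[_ == 0]negbK Euv => /negbTE nuv.
    apply/ens_seq1/ens_add/ens_write;
      rewrite /= !updE /= ?updE /= f5 f1 [u * n + v + _]addnC.
    split.
    * by move=> i j; rewrite adj_upd ?A2 // -addnA leq_addr.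
    * by rewrite outs_upd ?O2 // -[n * n + n + _]addnA orbC leq_add2l leq_addr.
    * by rewrite unc_upd_unc /= U2 /F nuv finset.setUC.
- by split.
Qed.

Lemma ens_mark_diag s :
  consts n 0 (reg s) ->
  adj (Defs.mem s) =2 e -> outs n (Defs.mem s) = finset.set0 ->
  unc n (Defs.mem s) = [set p | [exists y, [&& e p.1 y, e y p.2 & ~~ e p.1 p.2]]] ->
  ens (For 8 mark_diag) s (forT n 4) (fun s' =>
    [/\ consts n 0 (reg s'), adj (Defs.mem s') =2 reflcl e, outs n (Defs.mem s') =
      finset.set0 &
        unc n (Defs.mem s') = required e]).
Proof.
move=> cs As Os Us; have [c0 c1 c4 c5 [c6 c14]] := cs.
(* [Y] is the part of the diagonal already treated; it enters both the matrix and the table. *)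
pose J (Y : {set 'I_n * 'I_n}) (c : nat) m :=
  [/\ adj m =2 (fun i j => ((i, j) \in Y) || e i j), outs n m = finset.set0 &
    unc n m = Y :|: unc n (Defs.mem s)].
pose F (u : 'I_n) := [set (u, u)].
have step := @ens_for_big _ finset.set0 (@finset.setU _) n 8 mark_diag 4 J F finset.set0
  s c0 c1 isT.
apply: ens_weaken (leqnn _) _ (step _ _) => {step}.
- move=> s' [fr [A' O' U']].
  have inY (p : 'I_n * 'I_n) : (p \in finset.set0 :|: \bigcup_u F u) = (p.1 == p.2).
    rewrite finset.set0U; apply/finset.bigcupP/eqP => [[u _]|]; first by rewrite inE =>
      /eqP->.
    by case: p => u v /= ->; exists v; rewrite ?inE.
  split=> //; first by apply: consts_frame fr _ cs.
    by move=> i j; rewrite A' inY.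
  by rewrite U' Us; apply/setP => p; rewrite finset.in_setU inY !inE.
- move=> u s1 Y fr1 u8 u9 [A1 O1 U1].
  have cs1 : consts n 0 (reg s1) by apply: consts_frame fr1 _ cs.
  have [d0 d1 _ d5 _] := cs1.
  apply/ens_seq1/ens_add/ens_seq1/ens_write/ens_seq1/ens_add/ens_write.
  rewrite /= !updE /= ?updE /= u8 u9 d1 d5 [u * n + u + _]addnC; split.
  + move=> i j; rewrite adj_upd ?adj_upd_adj -?addnA ?leq_addr // A1 /F !inE.
    by case: (_ == _); rewrite ?orbT ?orbF.
  + by rewrite !outs_upd ?O1 ?cell_lt // -[n * n + n + _]addnA orbC leq_add2l leq_addr.
  + rewrite unc_upd_unc /= unc_upd ?(ltn_addr _ (cell_lt _ _)) // U1 /F.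
    by rewrite finset.setUA [[set _] :|: Y]finset.setUC.
- split=> //; last by rewrite finset.set0U.
  by move=> i j; rewrite As inE.
Qed.

Lemma ens_greedy_prog :
  ens (greedy_prog k) (input_state e) (greedyT k n) (fun s' =>
    greedy_inv R e k 0 (outs n (Defs.mem s')) (unc n (Defs.mem s'))).
Proof.
rewrite /greedy_prog /greedyT; apply/ens_seq1/ens_const/ens_seq.
set s0 := set_reg _ 1 1.
pose J l c m := c = l * n /\ m = Defs.mem (input_state e).
apply: ens_weaken (leqnn _) _ (@ens_for n 8 (Add 7 7 0) 1 J s0 erefl erefl isT _ _);
  last by [].
  move=> s1 [fr1 [s17 ms1]].
  apply/ens_seq1/ens_add/ens_seq1/ens_add/ens_seq; rewrite /= !updE /= ?updE /=.
  have r0 : reg s1 0 = n by rewrite fr1.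
  have r1 : reg s1 1 = 1 by rewrite fr1.
  have r6 : reg s1 6 = 0 by rewrite fr1.
  have r14 : reg s1 14 = 0 by rewrite fr1.
  rewrite s17 r14 addn0 r0; set s2 := set_reg _ 5 _.
  have cs2 : consts n 0 (reg s2) by split; rewrite /= !updE.
  have A2 : adj (Defs.mem s2) =2 e by rewrite /= ms1; exact: adj_input.
  have O2 : outs n (Defs.mem s2) = finset.set0.
    by apply/setP => i; rewrite /= ms1 !inE input_out // leq_addr.
  have U2 : unc n (Defs.mem s2) = finset.set0.
    by apply/setP => i; rewrite [LHS]inE /= ms1 inE input_out // -addnA leq_addr.
  apply: ens_weaken (leqnn _) _ (ens_mark_required cs2 A2 O2 U2) => s3 [cs3 A3 O3 U3].
  apply: ens_seq.
  apply: ens_weaken (leqnn _) _ (ens_mark_diag cs3 A3 O3 U3) => s4 [cs4 A4 O4 U4].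
  apply/ens_seq1/ens_add; set s5 := set_reg _ 6 _.
  (* The threshold register is also the loop test, so the loop ends at threshold 0, where
     [greedy_done] applies. *)
  pose I d s' := [/\ consts n d (reg s'), adj (Defs.mem s') =2 reflcl e &
    greedy_inv R e k d (outs n (Defs.mem s')) (unc n (Defs.mem s'))].
  have I5 : I (n * n) s5.
    split=> //.
      by have [d0 d1 d4 d5 [d6 d14]] := cs4; split; rewrite /= !updE //= d4 d14 addn0.
    by rewrite /= O4 U4; apply: greedy_init; rewrite card_ord.
  apply: ens_weaken (leqnn _) _ (@ens_while 6 _ (n * n) (passT k n + 1) I s5 _ _ I5) => //.
  - by move=> s' [].
  - by move=> d s' [[_ _ _ _ []]].
  move=> d s6 _ [cs6 A6 G6]; apply: ens_seq.
  apply: ens_weaken (leqnn _) _ (ens_all_walks (ltn0Sn d) cs6 (conj A6 G6)) =>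
    s7 [cs7 A7 G7].
  apply: ens_sub; split=> //=.
  by have [d0 d1 d4 d5 [d6 d14]] := cs7; split; rewrite !updE //= d6 d1 subn1.
move=> l s1 fr1 _ _ [s17 ms1]; apply: ens_add; split=> //.
by rewrite /= updE /= s17 fr1 // mulSn addnC.
Qed.

End Program.

(** * Running time and ratio *)

Definition poly_bounded (f : nat -> nat) : Prop :=
  exists P : {poly nat}, forall n, f n <= P.[n]%R.

Lemma poly_bounded_const c : poly_bounded (fun=> c).
Proof. by exists c%:P%R => n; rewrite hornerC. Qed.

Lemma poly_bounded_id : poly_bounded id.
Proof. by exists 'X%R => n; rewrite hornerX. Qed.

Lemma poly_boundedD f g :
  poly_bounded f -> poly_bounded g -> poly_bounded (fun n => f n + g n).
Proof. by move=> [P fP] [Q gQ]; exists (P + Q)%R => n; rewrite hornerD leq_add. Qed.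

Lemma poly_boundedM f g :
  poly_bounded f -> poly_bounded g -> poly_bounded (fun n => f n * g n).
Proof. by move=> [P fP] [Q gQ]; exists (P * Q)%R => n; rewrite hornerM leq_mul. Qed.

Lemma poly_boundedS f : poly_bounded f -> poly_bounded (fun n => (f n).+1).
Proof.
move=> bf; have [P fP] := poly_boundedD bf (poly_bounded_const 1).
by exists P => n; rewrite -addn1.
Qed.

Lemma poly_bounded_for f : poly_bounded f -> poly_bounded (fun n => forT n (f n)).
Proof.
move=> bf; apply: poly_boundedD (poly_bounded_const 4).
by apply: poly_boundedM poly_bounded_id _; do 4!apply: poly_boundedS.
Qed.

Lemma poly_bounded_rect T : poly_bounded (fun n => rectT n T).
Proof.
apply: poly_bounded_for; do 3!apply: poly_boundedS; apply: poly_bounded_for.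
exact: poly_bounded_const.
Qed.

Lemma poly_bounded_greedyT k : poly_bounded (greedyT k).
Proof.
have bn : poly_bounded (fun n => n * n) by apply: poly_boundedM; exact: poly_bounded_id.
have btry : poly_bounded (tryT k).
  apply/poly_boundedS/(poly_boundedD (poly_bounded_rect _)); do 2!apply: poly_boundedS.
  exact: poly_boundedD (poly_bounded_const _) (poly_bounded_rect _).
have bext j : poly_bounded (fun n => extT n (tryT k n) j).
  by elim: j => //= j IH; apply: poly_bounded_for; do 3!apply: poly_boundedS.
apply/poly_boundedS/(poly_boundedD (poly_bounded_for (poly_bounded_const 1))).
do 2!apply: poly_boundedS; apply/(poly_boundedD (poly_bounded_for (poly_bounded_rect 5))).
apply/(poly_boundedD (poly_bounded_for (poly_bounded_const 4))).
do 2!apply: poly_boundedS; apply: poly_boundedM bn _; apply: poly_boundedS.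
by apply: poly_boundedD (poly_bounded_const 1); apply: poly_bounded_for.
Qed.

(** * From the greedy bound to the approximation ratio *)

Section Ratio.

Variable R : realType.
Local Open Scope ring_scope.

Definition ratio_order (alpha n : nat) : R :=
  n%:R `^ (1 - alpha%:R^-1) * ln (n%:R) `^ (alpha%:R^-1).

(** Allows the additive 1 of the harmonic bound to be absorbed into the logarithm. *)
Lemma ln_ge_half (n : nat) : (1 < n)%N -> 2^-1 <= ln n%:R :> R.
Proof.
move=> n1; apply: (@le_trans _ _ (ln 2));
  last by rewrite ler_ln ?posrE ?ltr0n ?ler_nat //; exact: ltnW.
have : ln (1 + - 2^-1) <= - 2^-1 :> R by apply: le_ln1Dx; lra.
have -> : 1 + - 2^-1 = 2^-1 :> R by lra.
by rewrite lnV ?posrE // lerN2.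
Qed.

(* min(n, X) is at most the weighted geometric mean of n and X. *)
Lemma ratio_bound (alpha n d c k N : nat) : (0 < alpha)%N -> (1 < n)%N ->
  (d <= n)%N -> (d <= alpha * c)%N -> (N <= n * n)%N ->
  c%:R <= (k ^ alpha)%:R * harm R N ->
  d%:R <= (4 * alpha%:R) `^ (alpha%:R^-1) * ratio_order alpha n * k%:R.
Proof.
move=> a0 n1 dn dc Nn cb.
have ai0 : 0 <= alpha%:R^-1 :> R by rewrite invr_ge0.
have ai1 : alpha%:R^-1 <= 1 :> R by rewrite invf_le1 ?ltr0n // ler1n.
have L2 := ln_ge_half n1; set L := ln _ in L2 *.
have n0 : (0 < n)%N by exact: ltnW.
(* [1 + 2 * L <= 4 * L] because [L] is at least one half. *)
have hN : harm R N <= 4 * L.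
  apply: le_trans (harm_mono R Nn) _; apply: le_trans (harm_le_ln R _) _;
    first by rewrite muln_gt0 n0.
  by rewrite natrM lnM ?posrE ?ltr0n // -/L; lra.
have dX : d%:R <= 4 * alpha%:R * L * k%:R ^+ alpha :> R.
  apply: (@le_trans _ _ (alpha * c)%N%:R); first by rewrite ler_nat.
  rewrite natrM (_ : 4 * _ * L * _ = alpha%:R * (k%:R ^+ alpha * (4 * L))); last by ring.
  apply: ler_wpM2l => //; apply: le_trans cb _; rewrite natrX.
  by apply: ler_wpM2l => //; rewrite exprn_ge0.
(* The exponents sum to 1; the first factor is bounded through [d <= n], the second through [dX]. *)
have -> : d%:R = d%:R `^ (1 - alpha%:R^-1) * d%:R `^ (alpha%:R^-1) :> R.
  (* At [d = 0] the second factor vanishes because its exponent is nonzero. *)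
  have [->|dn0] := eqVneq d 0%N.
    by rewrite [in X in _ * X]powR0 ?mulr0 // invr_neq0 // pnatr_eq0 -lt0n.
  rewrite -powRD ?subrK ?powRr1 //; apply/implyP => _; by rewrite pnatr_eq0.
have -> : (4 * alpha%:R) `^ alpha%:R^-1 * ratio_order alpha n * k%:R =
    n%:R `^ (1 - alpha%:R^-1) * (4 * alpha%:R * L * k%:R ^+ alpha) `^ (alpha%:R^-1) :> R.
  have L0 : 0 <= L by lra.
  rewrite [in RHS]powRM ?mulr_ge0 ?exprn_ge0 // [in RHS]powRM ?mulr_ge0 //.
  have -> : (k%:R ^+ alpha) `^ (alpha%:R^-1) = k%:R :> R.
    by rewrite -powR_mulrn // -powRrM divff ?powRr1 // pnatr_eq0 -lt0n.
  by rewrite /ratio_order -/L; ring.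
apply: ler_pM; rewrite ?powR_ge0 //.
  by apply: ge0_ler_powR; rewrite ?nnegrE ?subr_ge0 ?ler_nat.
by apply: ge0_ler_powR; rewrite ?nnegrE //; apply: le_trans dX.
Qed.

End Ratio.

Lemma card_required_le (V : finType) (e : rel V) : #|required e| <= #|V| * #|V|.
Proof. by rewrite -card_prod; exact: max_card. Qed.

(** * Existence of the approximation algorithm *)

Local Open Scope classical_set_scope.
Local Open Scope ring_scope.

Theorem theorem2 (R : realType) (alpha : nat) (halpha : (1 < alpha)%N) :
  exists (r : nat -> R) (c : prog),
    (r =O_\oo (fun n : nat =>
       n%:R `^ (1 - alpha%:R^-1) * ln (n%:R) `^ (alpha%:R^-1))) /\
    polytime_approx alpha r c.
Proof.
case: alpha halpha => // k _.
pose C : R := (4 * k.+1%:R) `^ (k.+1%:R^-1).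
(* At [n = 1] the logarithmic factor vanishes, so the ratio is set to 1 there; the asymptotics do
   not change. *)
exists (fun n => if (n <= 1)%N then 1 else C * ratio_order R k.+1 n), (greedy_prog k);
  split.
  apply/eqO_exP; exists C; first by rewrite powR_gt0 // mulr_gt0.
  near=> n; rewrite ifN; last by rewrite -ltnNge; near: n; exact: nbhs_infty_gt.
  by rewrite normrM (ger0_norm (powR_ge0 _ _)).
have [P leP] := poly_bounded_greedyT k.
exists P => n e e_simple [n_gt0 _].
have [t [s [run le_t /(greedy_done e_simple)[feas [c [Dc cost]]]]]] :=
  ens_greedy_prog R k e.
exists t, s; split=> //; first exact: leq_trans (leP n).
move=> Dopt [feas_opt _]; rewrite -[output_set n s]/(outs n (Defs.mem s)).
have Dn : (#|outs n (Defs.mem s)| <= n)%N by rewrite -[leqRHS]card_ord max_card.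
case: ifP => [n1|/negbT n1].
  (* The output has at most one vertex, and a feasible set of a nonempty graph at least one. *)
  rewrite mul1r ler_nat (leq_trans Dn) // (leq_trans n1) //.
  exact: feasible_nonempty feas_opt.
(* Density is used with [m = #|Dopt| ^ k.+1]. *)
apply: ratio_bound (cost _ (feasible_dense e_simple feas_opt)) => //;
  first by rewrite ltnNge.
by rewrite -[n in (n * _)%N]card_ord -[n in (_ * n)%N]card_ord card_required_le.
Unshelve. all: by end_near.
Qed.
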